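(* Let $A\in M_n(\mathbb{Z})$ be invertible such that $x\mapsto A^{-1}x$ is a similarity with respect to Euclidean distance, and let $D\subset\mathbb{Z}^n$ be a subset of a complete residue system mod $A$. Let $\alpha\in T_{A,D-D}$ have a unique $(A,D-D)$-representation $(\alpha_j)_{j\ge1}$. Suppose there exist a positive integer $p$, finite sets $U_1,\dots,U_p, V_1,\dots,V_p\subset\mathbb{R}^n$ and a sequence $(\beta_j)_{j\ge1}\in D^{\mathbb{N}}$ such that, for all $j\ge1$, $$(D\cap(D+\alpha_j))-\beta_j=\begin{cases}U_j & 1\le j\le p,\\ U_\ell+V_\ell & j>p,\ j\equiv \ell \pmod p,\ \ell\in\{1,\dots,p\}.\end{cases}$$ Then $$\dim_H\big(T_{A,D}\cap(T_{A,D}+\alpha)\big)=\frac{\log\prod_{\ell=1}^p|U_\ell+V_\ell|}{p\log|\det(A)|^{1/n}}.$$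
   Context: A similarity means a map $f$ with $\|f(x)-f(y)\|=c\|x-y\|$ for some $c\in(0,1)$ and all $x,y$. For finite $E\subset\mathbb{R}^n$, $\pi_{A,E}((e_j)_{j\ge1})=\sum_{j\ge1}A^{-j}e_j$ for $(e_j)\in E^{\mathbb{N}}$, and $T_{A,E}=\pi_{A,E}(E^{\mathbb{N}})$. An $(A,E)$-representation of $x$ is a sequence $(e_j)\in E^{\mathbb{N}}$ with $\pi_{A,E}((e_j))=x$. $D-D=\{a-b:a,b\in D\}$, $D+t=\{d+t:d\in D\}$, $U+V=\{u+v:u\in U,v\in V\}$. A set $\mathcal{D}\subset\mathbb{Z}^n$ is a complete residue system mod $A$ if the canonical map $\mathcal{D}\to\mathbb{Z}^n/A\mathbb{Z}^n$ is bijective. *)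

(* Defs.v *)
From HB Require Import structures.
From mathcomp Require Import all_boot all_order all_algebra.
From mathcomp Require Import all_classical all_reals all_analysis.
From mathcomp Require Import finmap.
Set Implicit Arguments. Unset Strict Implicit. Unset Printing Implicit Defensive.
Import Order.TTheory GRing.Theory Num.Theory.
Import numFieldNormedType.Exports.
Local Open Scope classical_set_scope.
Local Open Scope ring_scope.

Definition eucl {R : realType} {n : nat} (x : 'cV[R]_n) : R :=
  Num.sqrt (\sum_(i < n) x i ord0 ^+ 2).

Definition is_similarity {R : realType} {n : nat} (f : 'cV[R]_n -> 'cV[R]_n) : Prop :=
  exists c : R, 0 < c < 1 /\ forall x y, eucl (f x - f y) = c * eucl (x - y).

Definition realmx {R : realType} {m n : nat} (A : 'M[int]_(m, n)) : 'M[R]_(m, n) :=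
  map_mx (fun z : int => z%:~R) A.
Definition realset {R : realType} {n : nat} (D : set 'cV[int]_n) : set 'cV[R]_n :=
  [set realmx d | d in D].

Definition Ainv {R : realType} {n : nat} (A : 'M[int]_n) : 'M[R]_n := invmx (realmx A).

Definition setdiff_vec {R : realType} {n : nat} (D E : set 'cV[R]_n) : set 'cV[R]_n :=
  [set x | exists a b, D a /\ E b /\ x = a - b].
Definition setadd_vec {R : realType} {n : nat} (U V : set 'cV[R]_n) : set 'cV[R]_n :=
  [set x | exists u v, U u /\ V v /\ x = u + v].
Definition translate {R : realType} {n : nat} (D : set 'cV[R]_n) (t : 'cV[R]_n) : set 'cV[R]_n :=
  [set d + t | d in D].

Definition complete_residue_system {n : nat} (A : 'M[int]_n) (C : set 'cV[int]_n) : Prop :=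
  (forall d1 d2, C d1 -> C d2 -> (exists z, d1 - d2 = A *m z) -> d1 = d2) /\
  (forall z : 'cV[int]_n, exists2 d, C d & exists w, z - d = A *m w).

(* (A,E)-representation.  A sequence (e_j)_{j>=1} is encoded 0-indexed:
   e k stands for e_{k+1}, so pi(e) = sum_{k>=0} A^{-(k+1)} e k. *)
Definition is_rep {R : realType} {n : nat} (A : 'M[int]_n) (E : set 'cV[R]_n)
  (x : 'cV[R]_n) (e : nat -> 'cV[R]_n) : Prop :=
  (forall k, E (e k)) /\
  (fun m : nat => \sum_(k < m) ((Ainv A ^+ k.+1) *m e k)) @ \oo --> x.

Definition T_AE {R : realType} {n : nat} (A : 'M[int]_n) (E : set 'cV[R]_n) : set 'cV[R]_n :=
  [set x | exists e, is_rep A E x e].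

Definition diam {R : realType} {n : nat} (S : set 'cV[R]_n) : \bar R :=
  ereal_sup [set (eucl (x - y))%:E | x in S & y in S].

Definition hterm {R : realType} {n : nat} (s : R) (S : set 'cV[R]_n) : \bar R :=
  if `[< S !=set0 >] then ((fine (diam S)) `^ s)%:E else 0%E.

Definition hausdorff_content {R : realType} {n : nat} (s delta : R) (E : set 'cV[R]_n) : \bar R :=
  ereal_inf [set (\sum_(i <oo) hterm s (F i))%E | F in
    [set F : nat -> set 'cV[R]_n | E `<=` \bigcup_i F i /\ forall i, (diam (F i) <= delta%:E)%E]].

Definition hausdorff_measure {R : realType} {n : nat} (s : R) (E : set 'cV[R]_n) : \bar R :=
  ereal_sup [set hausdorff_content s delta E | delta in [set d : R | 0 < d]].

Definition hausdorff_dim {R : realType} {n : nat} (E : set 'cV[R]_n) : \bar R :=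
  ereal_inf [set s%:E | s in [set s : R | 0 <= s /\ hausdorff_measure s E = 0%E]].

(* Main.v *)
Require Import Defs.
From HB Require Import structures.
From mathcomp Require Import all_boot all_order all_algebra.
From mathcomp Require Import all_classical all_reals all_analysis.
From mathcomp Require Import finmap.
From mathcomp Require Import zify ring lra.
Import Order.TTheory GRing.Theory Num.Theory.
Import numFieldNormedType.Exports.
Local Open Scope classical_set_scope.
Local Open Scope ring_scope.
Set Implicit Arguments.
Unset Strict Implicit.
Unset Printing Implicit Defensive.

(** By uniqueness of the representation [a] of [alpha], the intersection is the
    set of all sums of [A^-(k+1) d_k] with digits [d_k] in the [k]-th set
    [S k] = D :&: (D + a k).  Only the cardinalities of these sets matter, and
    from index [p] on they are periodic.  With [c] the ratio of [A^-1], the set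
    is covered at level [k] by [prod_(j<k) |S j|] pieces of diameter [O(c^k)],
    which gives the upper bound.  For the lower bound, distinct words of length
    [k] give distinct integer points [z] (the digits are distinct modulo [A]),
    so a set of diameter at most [c^k] is close to a bounded number of the
    points [A^-k z].  Given a cover with a small [s]-dimensional sum, the
    proportions of level-[k_i] points close to the [i]-th set add up to less
    than 1; descending always to a child for which the sum stays below 1 gives
    a point that no set of the cover contains, without any measure. *)

(** * Euclidean norm and convergence *)

Section Euclidean.
Variables (R : realType) (n : nat).
Implicit Types x y : 'cV[R]_n.

Lemma eucl_ge0 x : 0 <= eucl x.
Proof. exact: sqrtr_ge0. Qed.

Lemma eucl_sqr x : eucl x ^+ 2 = \sum_(i < n) x i ord0 ^+ 2.
Proof. by rewrite sqr_sqrtr// sumr_ge0// => i _; rewrite sqr_ge0. Qed.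

Lemma coord_le_eucl x i : `|x i ord0| <= eucl x.
Proof.
rewrite -(@ler_pXn2r _ 2)// ?nnegrE ?eucl_ge0//.
rewrite eucl_sqr real_normK ?num_real// (bigD1 i)//= lerDl sumr_ge0// => j _.
by rewrite sqr_ge0.
Qed.

(** Squaring the right-hand side adds only nonnegative cross terms to the sum of squares. *)
Lemma eucl_le_sum x : eucl x <= \sum_(i < n) `|x i ord0|.
Proof.
have s0 (r : seq 'I_n) : 0 <= \sum_(i <- r) `|x i ord0|.
  by rewrite sumr_ge0.
rewrite -(@ler_pXn2r _ 2)// ?nnegrE ?eucl_ge0// ?s0// eucl_sqr.
elim: (index_enum _) (s0) => [|i r ih] _; first by rewrite !big_nil expr0n.
rewrite !big_cons sqrrD real_normK ?num_real// -addrA lerD2l.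
by rewrite ler_wpDl ?ih// mulrn_wge0// mulr_ge0.
Qed.

Lemma eucl_le_coord x b : (forall i, `|x i ord0| <= b) -> eucl x <= n%:R * b.
Proof.
move=> xb; apply: le_trans (eucl_le_sum x) _.
apply: le_trans (ler_sum _ (fun i _ => xb i)) _.
by rewrite sumr_const card_ord mulr_natl.
Qed.

Lemma cvg_coord (u : nat -> 'cV[R]_n) x : u @ \oo --> x <->
  forall i, (fun m => u m i ord0) @ \oo --> x i ord0.
Proof.
split=> [ux i|ux].
  exact: cvg_trans (cvg_app (fun v : 'cV[R]_n => v i ord0) ux)
    (@coord_continuous _ _ _ i ord0 x).
apply/cvg_ballP => e e0.
have : \forall m \near \oo, forall i, `|x i ord0 - u m i ord0| < e.
  by apply: filter_forall => i; exact: (cvgrPdist_lt _ _).1 (ux i) _ e0.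
apply: filterS => m xu; split=> // i j.
by rewrite [j]ord1; exact: xu.
Qed.

End Euclidean.

(* [Defs.realmx] must be qualified: MathComp has another [realmx]. *)
Section RealMatrices.
Variable R : realType.
Local Notation rmx := (@Defs.realmx R _ _).

Lemma realmx_inj m n : injective (@Defs.realmx R m n).
Proof.
move=> M N /matrixP MN; apply/matrixP => i j; have := MN i j.
by rewrite !mxE; exact: intr_inj.
Qed.

Lemma realmxB m n (M N : 'M[int]_(m, n)) : rmx (M - N) = rmx M - rmx N.
Proof. exact: map_mxB. Qed.

Lemma realmxD m n (M N : 'M[int]_(m, n)) : rmx (M + N) = rmx M + rmx N.
Proof. exact: map_mxD. Qed.

Lemma realmxM m n l (M : 'M[int]_(m, n)) (N : 'M[int]_(n, l)) :
  rmx (M *m N) = rmx M *m rmx N.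
Proof. exact: map_mxM. Qed.

Lemma realmx_unit n (A : 'M[int]_n) : \det A != 0 -> rmx A \in unitmx.
Proof. by move=> A0; rewrite unitmxE det_map_mx unitfE intr_eq0. Qed.

End RealMatrices.

(** * Convergence of digit expansions under a contracting similarity *)

Section Similarity.
Variables (R : realType) (n : nat) (A : 'M[int]_n) (c : R).
Hypothesis detA : \det A != 0.
Hypothesis c01 : 0 < c < 1.
Hypothesis eucl_Ainv : forall x : 'cV[R]_n, eucl (Ainv A *m x) = c * eucl x.
Local Notation rmx := (@Defs.realmx R _ _).

Lemma AinvK (x : 'cV[R]_n) : Ainv A *m (rmx A *m x) = x.
Proof. by rewrite mulmxA mulVmx ?mul1mx// realmx_unit. Qed.

Lemma AinvXSr k (x : 'cV[R]_n) :
  Ainv A ^+ k.+1 *m x = Ainv A ^+ k *m (Ainv A *m x).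
Proof. by rewrite exprSr -mulmxE mulmxA. Qed.

Lemma eucl_AinvX k (x : 'cV[R]_n) : eucl (Ainv A ^+ k *m x) = c ^+ k * eucl x.
Proof.
elim: k x => [|k ih] x; first by rewrite !expr0 mul1r mul1mx.
by rewrite AinvXSr ih eucl_Ainv mulrA -exprSr.
Qed.

Definition psum (e : nat -> 'cV[R]_n) (m : nat) : 'cV[R]_n :=
  \sum_(k < m) (Ainv A ^+ k.+1 *m e k).

Section BoundedDigits.
Variables (B : R) (e : nat -> 'cV[R]_n).
Hypothesis eB : forall k, eucl (e k) <= B.

Let c_ge0 : 0 <= c. Proof. by case/andP: c01 => /ltW. Qed.
Let c_lt1 : c < 1. Proof. by case/andP: c01. Qed.

Lemma psum_term k i : `|(Ainv A ^+ k.+1 *m e k) i ord0| <= B * c ^+ k.+1.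
Proof.
apply: le_trans (coord_le_eucl _ _) _.
by rewrite eucl_AinvX mulrC ler_wpM2r// exprn_ge0.
Qed.

Lemma psum_tail k r i :
  `|(psum e (k + r) - psum e k) i ord0| <= B / (1 - c) * c ^+ k.
Proof.
have B0 : 0 <= B := le_trans (eucl_ge0 _) (eB 0).
have c1 : 0 < 1 - c by rewrite subr_gt0.
(* The factor [c ^+ k - c ^+ (k + r)] leaves room for the next term, so the induction on [r] closes;
   it is weakened to [c ^+ k] afterwards. *)
have : `|(psum e (k + r) - psum e k) i ord0| <=
    B / (1 - c) * (c ^+ k - c ^+ (k + r)).
  elim: r => [|r ih]; first by rewrite addn0 !subrr mxE normr0 mulr0.
  rewrite addnS {1}/psum big_ord_recr/= -/(psum e (k + r)) addrAC mxE.
  apply: le_trans (ler_normD _ _) _.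
  apply: le_trans (lerD ih (psum_term _ _)) _.
  have w0 : 0 <= B * c ^+ (k + r) by rewrite mulr_ge0// exprn_ge0.
  have -> : B / (1 - c) * (c ^+ k - c ^+ (k + r).+1) =
      B / (1 - c) * (c ^+ k - c ^+ (k + r)) + B * c ^+ (k + r).
    by rewrite exprS; field; rewrite gt_eqF.
  by rewrite lerD2l exprS mulrCA ler_piMl// ltW.
move=> /le_trans; apply; apply: ler_wpM2l; first by rewrite divr_ge0// ltW.
by rewrite gerBl exprn_ge0.
Qed.

Lemma psum_near (x : 'cV[R]_n) k i : psum e @ \oo --> x ->
  `|(x - psum e k) i ord0| <= B / (1 - c) * c ^+ k.
Proof.
move=> /cvg_coord/(_ i) ex.
have : (fun r => `|(psum e (k + r)%N - psum e k) i ord0|) @ \oo -->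
    `|(x - psum e k) i ord0|.
  apply: cvg_norm; under eq_fun do rewrite !mxE.
  rewrite !mxE; apply: cvgB; last exact: cvg_cst.
  by under eq_fun do rewrite addnC; move: ex; rewrite -(cvg_shiftn k).
move=> h; rewrite -(cvg_lim _ h)//; apply: limr_le.
  by apply/cvg_ex; eexists; exact: h.
by apply: nearW => r; exact: psum_tail.
Qed.

(** Each coordinate series is dominated by a geometric series of ratio [c]. *)
Lemma psum_cvg : exists x : 'cV[R]_n, psum e @ \oo --> x.
Proof.
pose u i := [sequence (Ainv A ^+ k.+1 *m e k) i ord0]_k.
have cu i : cvg (series (u i) @ \oo).
  apply: normed_cvg.
  have : cvg (series (geometric (B * c) c) @ \oo).
    by apply: is_cvg_geometric_series; rewrite ger0_norm.
  apply: series_le_cvg => k //=.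
  - by rewrite /geometric /= -mulrA -exprS mulr_ge0 ?exprn_ge0//
      (le_trans (eucl_ge0 _) (eB 0)).
  - by rewrite -mulrA -exprS; exact: psum_term.
exists (\col_i lim (series (u i) @ \oo)); apply/cvg_coord => i.
rewrite mxE.
have -> : (fun m => psum e m i ord0) = series (u i); last exact: cu.
by apply/funext => m; rewrite /psum summxE /series/= big_mkord.
Qed.

End BoundedDigits.

End Similarity.

(** * Hausdorff measure *)

Section Hausdorff.
Variables (R : realType) (n : nat).
Implicit Types (S E : set 'cV[R]_n) (s b : R).

Lemma diam_le S b : (forall x y, S x -> S y -> eucl (x - y) <= b) ->
  (diam S <= b%:E)%E.
Proof.
move=> Sb; apply: ge_ereal_sup => _ [x Sx [y Sy <-]].
by rewrite lee_fin Sb.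
Qed.

Lemma eucl_le_diam S x y : S x -> S y -> ((eucl (x - y))%:E <= diam S)%E.
Proof. by move=> Sx Sy; apply: ereal_sup_ubound; exists x => //; exists y. Qed.

Lemma diam_set0 : diam (set0 : set 'cV[R]_n) = -oo%E.
Proof.
rewrite /diam (_ : [set _ | _ in _ & _ in _] = set0) ?ereal_sup0//.
by apply/seteqP; split=> // _ [x []].
Qed.

(** The empty set has diameter [-oo], which [fine] sends to 0. *)
Lemma fine_diam_ge0 S : 0 <= fine (diam S).
Proof.
have [->|/set0P[x Sx]] := eqVneq S set0; first by rewrite diam_set0.
by apply: fine_ge0; apply: le_trans (eucl_le_diam Sx Sx); rewrite lee_fin eucl_ge0.
Qed.

Lemma eucl_le_fine_diam S b x y : (diam S <= b%:E)%E -> S x -> S y ->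
  eucl (x - y) <= fine (diam S).
Proof.
move=> Sb Sx Sy; rewrite -lee_fin fineK ?eucl_le_diam//.
rewrite fin_numElt (le_lt_trans Sb) ?ltry// andbT.
by apply: lt_le_trans (eucl_le_diam Sx Sy); rewrite ltNyr.
Qed.

Lemma hterm_ge0 s S : (0 <= hterm s S)%E.
Proof. by rewrite /hterm; case: ifP => // _; rewrite lee_fin powR_ge0. Qed.

Lemma hterm_set0 s : hterm s (set0 : set 'cV[R]_n) = 0%E.
Proof. by rewrite /hterm asboolF// => -[]. Qed.

Lemma hterm_le s S b : 0 <= s -> 0 <= b -> (diam S <= b%:E)%E ->
  (hterm s S <= (b `^ s)%:E)%E.
Proof.
move=> s0 b0 Sb; rewrite /hterm; case: ifP => _; rewrite lee_fin ?powR_ge0//.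
rewrite ge0_ler_powR// ?nnegrE ?fine_diam_ge0//.
by case: (diam S) Sb => [r||]; rewrite ?lee_fin.
Qed.

Lemma hausdorff_content_ge0 s b E : (0 <= hausdorff_content s b E)%E.
Proof.
apply: le_ereal_inf_tmp => _ [F _ <-].
by apply: nneseries_ge0 => i _ _; exact: hterm_ge0.
Qed.

Lemma hausdorff_measure_eq0_cover s E d e : hausdorff_measure s E = 0%E ->
  0 < d -> 0 < e -> exists F : nat -> set 'cV[R]_n,
    [/\ E `<=` \bigcup_i F i, forall i, (diam (F i) <= d%:E)%E &
        (\sum_(i <oo) hterm s (F i) < e%:E)%E].
Proof.
move=> H0 d0 e0; have : (hausdorff_content s d E < e%:E)%E.
  apply: (@le_lt_trans _ _ 0%E); last by rewrite lte_fin.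
  by rewrite -H0; apply: ereal_sup_ubound; exists d.
by move=> /ereal_inf_lt[_ [F [EF Fd] <-] Fe]; exists F.
Qed.

(** A finite cover becomes a countable one by padding with empty sets, which have diameter [-oo] and
    contribute 0. *)
Lemma hausdorff_measure_eq0 s E : 0 <= s ->
  (forall d e, 0 < d -> 0 < e -> exists (G : seq (set 'cV[R]_n)) b,
    [/\ forall x, E x -> exists2 i, (i < size G)%N & nth set0 G i x,
        forall i, (i < size G)%N -> (diam (nth set0 G i) <= b%:E)%E,
        0 <= b <= d & (size G)%:R * b `^ s <= e]) ->
  hausdorff_measure s E = 0%E.
Proof.
move=> s0 EG; apply/eqP; rewrite eq_le; apply/andP; split; last first.
  apply: le_trans (hausdorff_content_ge0 s 1 E) _.
  by apply: ereal_sup_ubound; exists 1 => //=; rewrite ltr01.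
apply: ge_ereal_sup => _ [d /= d0 <-].
apply/lee_addgt0Pr => e e0; rewrite add0e.
have [G [b [GE Gb /andP[b0 bd] Ge]]] := EG d e d0 e0.
apply: (@le_trans _ _ (\sum_(i <oo) hterm s (nth set0 G i))%E).
  apply: ereal_inf_lbound; exists (nth set0 G) => //; split=> [x /GE[i _ ?]|i].
    by exists i.
  have [iG|Gi] := ltnP i (size G).
    by apply: le_trans (Gb _ iG) _; rewrite lee_fin.
  by rewrite nth_default// diam_set0 leNye.
rewrite (nneseries_split 0 (size G)); last by move=> *; exact: hterm_ge0.
rewrite add0n eseries0 ?adde0; last first.
  by move=> i Gi _; rewrite nth_default// hterm_set0.
apply: (@le_trans _ _ (\sum_(0 <= i < size G) (b `^ s)%:E)%E).
  rewrite big_nat [leRHS]big_nat; apply: lee_sum => i /andP[_ iG].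
  by rewrite hterm_le// Gb.
by rewrite sumEFin lee_fin sumr_const_nat subn0 -mulr_natl.
Qed.

Lemma hausdorff_dimE E s0 : 0 <= s0 ->
  (forall s, s0 < s -> hausdorff_measure s E = 0%E) ->
  (forall s, 0 <= s < s0 -> hausdorff_measure s E <> 0%E) ->
  hausdorff_dim E = s0%:E.
Proof.
move=> s00 Hgt Hlt; apply/eqP; rewrite eq_le; apply/andP; split.
  apply/lee_addgt0Pr => e e0; apply: ereal_inf_lbound.
  by exists (s0 + e) => //; split; [lra|apply: Hgt; lra].
apply: le_ereal_inf_tmp => _ [s [s_ge0 Hs] <-]; rewrite lee_fin leNgt.
by apply/negP => ss0; apply: (Hlt s) => //; rewrite s_ge0.
Qed.

End Hausdorff.

(** * The digit set and its upper bound *)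

Lemma geometric_small (R : realType) (r a e : R) : 0 <= r < 1 -> 0 < e ->
  \forall k \near \oo, a * r ^+ k <= e.
Proof.
move=> /andP[r0 r1] e0.
have : (fun k => a * r ^+ k) @ \oo --> (0 : R).
  by apply: cvg_geometric; rewrite ger0_norm.
move=> /cvgrPdist_le/(_ e e0); apply: filterS => k.
by rewrite sub0r normrN => /(le_trans (ler_norm _)).
Qed.

Lemma powRX (R : realType) (x s : R) k : 0 <= x -> (x ^+ k) `^ s = (x `^ s) ^+ k.
Proof.
by move=> x0; rewrite -(powR_mulrn k x0) -(powR_mulrn k (powR_ge0 _ _)) powRAC.
Qed.

Section DigitSystem.
Variables (n : nat) (A : 'M[int]_n) (S : nat -> seq 'cV[int]_n).

(** A level-[k] partial sum multiplied by A^k is an integer vector; Horner's rule lists these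
    vectors, which turns distinctness and proximity into questions about the lattice. *)
Fixpoint level k : seq 'cV[int]_n :=
  if k is k'.+1 then [seq A *m z + d | z <- level k', d <- S k'] else [:: 0].

Fixpoint intpt (e : nat -> 'cV[int]_n) k : 'cV[int]_n :=
  if k is k'.+1 then A *m intpt e k' + e k' else 0.

Lemma intpt_level e k : (forall j, e j \in S j) -> intpt e k \in level k.
Proof.
by move=> eS; elim: k => [|k ih] /=; [rewrite inE | apply: allpairs_f].
Qed.

Lemma size_levelS k : size (level k.+1) = (size (level k) * size (S k))%N.
Proof. by rewrite size_allpairs. Qed.

Lemma size_level k : size (level k) = (\prod_(j < k) size (S j))%N.
Proof.
elim: k => [|k ih]; first by rewrite big_ord0.
by rewrite size_levelS ih big_ord_recr.
Qed.

Hypothesis detA : \det A != 0.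
Hypothesis S_uniq : forall k, uniq (S k).
Hypothesis S_residue : forall k d1 d2 z, d1 \in S k -> d2 \in S k ->
  d1 - d2 = A *m z -> d1 = d2.

(** Multiplying by the adjugate replaces [A], which need not be invertible over the integers, by the
    nonzero scalar [\det A]. *)
Lemma mulmx_int_inj : injective (fun z : 'cV[int]_n => A *m z).
Proof.
move=> z1 z2 /(congr1 (mulmx (\adj A))).
rewrite !mulmxA !mul_adj_mx !mul_scalar_mx => /matrixP z12.
by apply/matrixP => i j; have := z12 i j; rewrite !mxE; exact: mulfI.
Qed.

(** If A z1 + d1 = A z2 + d2, the digits agree modulo [A], hence are equal, and then [A] cancels. *)
Lemma level_uniq k : uniq (level k).
Proof.
elim: k => // k ih; apply: allpairs_uniq => // -[z1 d1] [z2 d2].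
move=> /allpairsP[[_ d1'] /= [_ d1S [_ ->]]].
move=> /allpairsP[[_ d2'] /= [_ d2S [_ ->]]] /= zd.
have d12 : d1' = d2'.
  apply: (@S_residue k _ _ (z2 - z1)) => //.
  by rewrite mulmxBr -[A *m z2](addrK d2') -zd [_ *m _ + _]addrC addrAC addrK.
by move: zd; rewrite d12 => /addIr/mulmx_int_inj ->.
Qed.

End DigitSystem.

Section DigitSet.
Variables (R : realType) (n : nat) (A : 'M[int]_n) (c B : R).
Variable S : nat -> seq 'cV[int]_n.
Hypothesis detA : \det A != 0.
Hypothesis c01 : 0 < c < 1.
Hypothesis eucl_Ainv : forall x : 'cV[R]_n, eucl (Ainv A *m x) = c * eucl x.
Hypothesis S_bounded : forall k d, d \in S k ->
  eucl (Defs.realmx d : 'cV[R]_n) <= B.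
Hypothesis S_nonempty : forall k, (0 < size (S k))%N.
Local Notation rmx := (@Defs.realmx R _ _).
Local Notation lev := (level A S).
Local Notation C := (B / (1 - c)).

Definition digit_set : set 'cV[R]_n :=
  [set x | exists e, (forall k, e k \in S k) /\
                     psum A (fun k => rmx (e k)) @ \oo --> x].

Let c_gt0 : 0 < c. Proof. by case/andP: c01. Qed.
Let c_lt1 : c < 1. Proof. by case/andP: c01. Qed.
Let C_ge0 : 0 <= C.
Proof.
case: (S 0%N) (S_nonempty 0) (@S_bounded 0%N) => // d r _ /(_ d).
rewrite inE eqxx => /(_ isT) dB; rewrite divr_ge0 ?(le_trans (eucl_ge0 _) dB)//.
by rewrite subr_ge0 ltW.
Qed.

Lemma psum_intpt e k :
  psum A (fun j => rmx (e j)) k = Ainv A ^+ k *m rmx (intpt A e k).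
Proof.
elim: k => [|k ih]; first by rewrite /psum big_ord0 /Defs.realmx map_mx0 mulmx0.
rewrite /psum big_ord_recr/= -/(psum A (fun j => rmx (e j)) k) ih.
by rewrite realmxD realmxM mulmxDr; congr (_ + _); rewrite AinvXSr AinvK.
Qed.

Lemma digit_set_near e (x : 'cV[R]_n) k i : (forall k, e k \in S k) ->
  psum A (fun j => rmx (e j)) @ \oo --> x ->
  `|(x - Ainv A ^+ k *m rmx (intpt A e k)) i ord0| <= C * c ^+ k.
Proof.
move=> eS ex; rewrite -psum_intpt; apply: psum_near => // j.
exact: S_bounded.
Qed.

Section Growth.
Variables (s0 K : R).
Hypothesis s0_ge0 : 0 <= s0.
Hypothesis growth_le : forall k, (size (lev k))%:R * (c `^ s0) ^+ k <= K.

Lemma hausdorff_measure_digit_set0 s : s0 < s ->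
  hausdorff_measure s digit_set = 0%E.
Proof.
move=> s0s; have s_gt0 : 0 < s by apply: le_lt_trans s0s.
apply: hausdorff_measure_eq0 => [|d e d0 e0]; first exact: ltW.
(* Two points of one box below differ by at most 2 C c^k in each coordinate, hence by at most M c^k
   in norm. *)
pose M := n%:R * (2 * C); have M0 : 0 <= M by apply: mulr_ge0 => //; apply: mulr_ge0.
(* The part of c^(s k) left over once [growth_le] has absorbed c^(s0 k) is r^k, which tends to 0. *)
pose r := c `^ (s - s0).
have r01 : 0 <= r < 1.
  rewrite powR_ge0 /r /powR gt_eqF//= -expR0 ltr_expR.
  by rewrite pmulr_rlt0 ?subr_gt0// ln_lt0// c_gt0.
have c01' : 0 <= c < 1 by rewrite ltW.
have [k [kd ke]] : exists k, M * c ^+ k <= d /\ M `^ s * K * r ^+ k <= e.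
  have := filterI (geometric_small M c01' d0) (geometric_small (M `^ s * K) r01 e0).
  by case=> k _ /(_ k (leqnn _)) /= kk; exists k.
pose box (z : 'cV[int]_n) : set 'cV[R]_n :=
  [set x | forall i, `|(x - Ainv A ^+ k *m rmx z) i ord0| <= C * c ^+ k].
exists (map box (lev k)), (M * c ^+ k); split.
- move=> x [f [fS fx]]; have zl := intpt_level A k fS.
  exists (index (intpt A f k) (lev k)); first by rewrite size_map index_mem zl.
  rewrite (nth_map 0) ?index_mem// nth_index// => i.
  exact: digit_set_near.
- move=> i; rewrite size_map => ik; rewrite (nth_map 0)//.
  apply: diam_le => x y xb yb; rewrite /M -mulrA; apply: eucl_le_coord => j.
  have -> : (x - y) j ord0 = (x - Ainv A ^+ k *m rmx (nth 0 (lev k) i)) j ord0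
      - (y - Ainv A ^+ k *m rmx (nth 0 (lev k) i)) j ord0.
    by rewrite !mxE; ring.
  apply: le_trans (ler_normB _ _) _.
  by have := xb j; have := yb j; lra.
- by rewrite kd mulr_ge0// exprn_ge0// ltW.
- have c_ge0 := ltW c_gt0.
  rewrite size_map powRM ?exprn_ge0//; apply: le_trans ke.
  rewrite powRX// mulrCA -mulrA ler_wpM2l ?powR_ge0//.
  have -> : (c `^ s) ^+ k = (c `^ s0) ^+ k * r ^+ k.
    have /powRD powRDc : (s0 + (s - s0) == 0) ==> (c != 0).
      by rewrite (gt_eqF c_gt0) implybT.
    by rewrite -exprMn -powRDc subrKC.
  by rewrite mulrA ler_wpM2r ?growth_le// exprn_ge0// powR_ge0.
Qed.

End Growth.
End DigitSet.

(** * Lower bound *)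

Section Averages.
Variables (R : realType) (n : nat) (A : 'M[int]_n) (S : nat -> seq 'cV[int]_n).
Hypothesis S_nonempty : forall k, (0 < size (S k))%N.
Implicit Types (h : 'cV[int]_n -> bool) (z : 'cV[int]_n).

(* Since all points of a level have equally many children, this is the proportion
   of the [r]-step descendants of the level-[k] point [z] that satisfy [h]. *)
Fixpoint avg h r k z : R :=
  if r is r'.+1 then
    (\sum_(d <- S k) avg h r' k.+1 (A *m z + d)) / (size (S k))%:R
  else (h z)%:R.

Let size_neq0 k : (size (S k))%:R != 0 :> R.
Proof. by rewrite pnatr_eq0 -lt0n. Qed.

Lemma size_level_gt0 k : (0 < size (level A S k))%N.
Proof. by elim: k => // k ih; rewrite size_levelS muln_gt0 ih S_nonempty. Qed.

Lemma avg_ge0 h r k z : 0 <= avg h r k z.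
Proof.
elim: r k z => [|r ih] k z /=; first by rewrite ler0n.
by rewrite divr_ge0// sumr_ge0.
Qed.

(** All points of level [k] have equally many descendants at level [k + r], namely the quotient of
    the two sizes; the proportions thus sum to the count divided by this quotient. *)
Lemma sum_avg h r k : \sum_(z <- level A S k) avg h r k z =
  (count h (level A S (k + r)))%:R *
  ((size (level A S k))%:R / (size (level A S (k + r)))%:R).
Proof.
elim: r k => [|r ih] k.
  rewrite addn0 divff ?pnatr_eq0 -?lt0n ?size_level_gt0// mulr1.
  rewrite -sum1_count natr_sum [RHS]big_mkcond.
  by apply: eq_bigr => z _ /=; case: (h z).
rewrite /= -mulr_suml addnS -addSn.
have := ih k.+1; rewrite [X in X = _]big_allpairs_dep => ->.
rewrite size_levelS natrM; field.
by rewrite size_neq0 pnatr_eq0 -lt0n size_level_gt0.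
Qed.

Lemma avg_root h r :
  avg h r 0 0 = (count h (level A S r))%:R / (size (level A S r))%:R.
Proof. by have := sum_avg h r 0; rewrite big_seq1 mul1r. Qed.

Section Path.
Variables (h : nat -> 'cV[int]_n -> bool) (depth : nat -> nat).

(* Vanishing beyond [depth i] keeps [g i] a supermartingale. *)
Let g i k z := if (k <= depth i)%N then avg (h i) (depth i - k) k z else 0.
Let H k z : \bar R := (\sum_(i <oo) (g i k z)%:E)%E.

Let g_ge0 i k z : 0 <= g i k z.
Proof. by rewrite /g; case: ifP => // _; exact: avg_ge0. Qed.

Let g_step i k z :
  \sum_(d <- S k) g i k.+1 (A *m z + d) <= (size (S k))%:R * g i k z.
Proof.
rewrite /g; case: (ltnP k (depth i)) => [ki|_].
  by rewrite (ltnW ki) -(subnSK ki)/= mulrC divfK.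
by rewrite big1// mulr_ge0//; case: ifP => // _; exact: avg_ge0.
Qed.

(** By [g_step], the average of [H] over the children of [z] is at most [H k z]; if all children had
    value at least 1, so would the average. *)
Let H_step k z : (H k z < 1)%E ->
  exists2 d, d \in S k & (H k.+1 (A *m z + d) < 1)%E.
Proof.
move=> Hz; apply: contrapT => nd.
have Hd d : d \in S k -> (1 <= H k.+1 (A *m z + d))%E.
  by move=> dS; rewrite leNgt; apply/negP => Hd; apply: nd; exists d.
have : ((size (S k))%:R%:E <= (size (S k))%:R%:E * H k z)%E.
  apply: (@le_trans _ _ (\sum_(d <- S k) H k.+1 (A *m z + d)))%E.
    apply: (@le_trans _ _ (\sum_(d <- S k) 1%:E)%E).
      by rewrite sumEFin lee_fin big_const_seq iter_addr_0 count_predT.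
    by rewrite big_seq [leRHS]big_seq; apply: lee_sum => d /Hd.
  rewrite -nneseries_sum; last by move=> d i _; rewrite lee_fin.
  rewrite /H -nneseriesZl; last by move=> i _; rewrite lee_fin.
  apply: lee_nneseries => i _; first move=> _.
    by rewrite sume_ge0// => d _; rewrite lee_fin.
  by rewrite sumEFin -EFinM lee_fin g_step.
apply/negP; rewrite -ltNge -[ltRHS]mule1.
by rewrite lte_pmul2l// lte_fin ltr0n.
Qed.

Lemma avoiding_path : (\sum_(i <oo) (avg (h i) (depth i) 0 0)%:E < 1)%E ->
  exists2 e, forall k, e k \in S k & forall i, ~~ h i (intpt A e (depth i)).
Proof.
move=> root.
(* The choice function has to be total; where [H] is not below 1 it takes the dummy value 0. *)
have : forall kz, exists d, (H kz.1 kz.2 < 1)%E ->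
    d \in S kz.1 /\ (H kz.1.+1 (A *m kz.2 + d) < 1)%E.
  move=> [k z] /=; have [/H_step[d dS Hd]|nH] := pselect (H k z < 1)%E.
    by exists d.
  by exists 0.
move=> /choice[next nextP].
(* Each digit depends on the point reached so far, so the points are constructed first and
   identified with [intpt e] in [ste]. *)
pose fix st k := if k is k'.+1 then A *m st k' + next (k', st k') else 0.
pose e k := next (k, st k).
have ste k : intpt A e k = st k by elim: k => //= k ->.
have Hst k : (H k (st k) < 1)%E.
  elim: k => [|k ih]; last by have [] := nextP (k, st k) ih.
  by rewrite /H; under eq_eseriesr do rewrite /g leq0n subn0.
exists e => [k|i]; first by have [] := nextP (k, st k) (Hst k).
rewrite ste; apply/negP => hi.
(* At level [depth i] the term [g i] is the indicator of [h i], so a point satisfying [h i] would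
   push [H] up to 1. *)
have : ((g i (depth i) (st (depth i)))%:E <= H (depth i) (st (depth i)))%E.
  apply: (le_trans _ (@nneseries_lim_ge _ _ xpredT 0 i.+1 _)) => /=; last first.
    by move=> j _ _; rewrite lee_fin.
  by rewrite big_nat_recr//= leeDr// sume_ge0// => j _; rewrite lee_fin.
by rewrite /g leqnn subnn /= hi leNgt Hst.
Qed.

End Path.
End Averages.

(** Differences from the first vector have coordinates strictly between [-m] and [m]; shifted by
    [m], they embed the list into a finite type of functions. *)
Lemma bounded_int_vectors (R : realType) (n : nat) (rho : R) :
  exists M : nat, forall s : seq 'cV[int]_n, uniq s ->
    (forall z z', z \in s -> z' \in s ->
       eucl (Defs.realmx (z - z') : 'cV[R]_n) <= rho) -> (size s <= M)%N.
Proof.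
pose m := (Num.truncn rho).+1.
exists #|{ffun 'I_n -> 'I_(m + m).+1}| => -[//|z0 s] us sr.
pose f (z : 'cV[int]_n) : {ffun 'I_n -> 'I_(m + m).+1} :=
  [ffun i => inord `|((z - z0) i ord0 + m%:Z)%R|%N].
have zm z i : z \in z0 :: s -> (`|((z - z0) i ord0)%R|%N < m)%N.
  move=> zs; rewrite -(ltr_nat R) (le_lt_trans _ (truncnS_gt rho))//.
  have z0s : z0 \in z0 :: s by rewrite inE eqxx.
  apply: le_trans (sr z z0 zs z0s); apply: le_trans (coord_le_eucl _ i).
  by rewrite [X in _ <= `|X|]mxE -intr_norm -abszE -pmulrn.
rewrite -(size_map f) -(card_uniqP _) ?max_card// map_inj_in_uniq// => z z' zs z's.
move=> /ffunP ff; apply/matrixP => i j; rewrite [j]ord1.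
have /(congr1 (@nat_of_ord _)) := ff i; rewrite !ffunE.
have := zm z i zs; have := zm z' i z's; rewrite !mxE.
move: (z i ord0) (z' i ord0) (z0 i ord0) => u v w; move: {zm f ff} m => m h1 h2.
rewrite !inordK; first lia.
  lia.
lia.
Qed.

Section LowerBound.
Variables (R : realType) (n : nat) (A : 'M[int]_n) (c B : R).
Variable S : nat -> seq 'cV[int]_n.
Hypothesis detA : \det A != 0.
Hypothesis c01 : 0 < c < 1.
Hypothesis eucl_Ainv : forall x : 'cV[R]_n, eucl (Ainv A *m x) = c * eucl x.
Hypothesis S_bounded : forall k d, d \in S k ->
  eucl (Defs.realmx d : 'cV[R]_n) <= B.
Hypothesis S_nonempty : forall k, (0 < size (S k))%N.
Hypothesis S_uniq : forall k, uniq (S k).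
Hypothesis S_residue : forall k d1 d2 z, d1 \in S k -> d2 \in S k ->
  d1 - d2 = A *m z -> d1 = d2.
Local Notation rmx := (@Defs.realmx R _ _).
Local Notation lev := (level A S).
Local Notation C := (B / (1 - c)).

Let c_gt0 : 0 < c. Proof. by case/andP: c01. Qed.
Let c_lt1 : c < 1. Proof. by case/andP: c01. Qed.

(** The box around A^-k z contains every point of the digit set whose first [k] digits lead to [z],
    so [F] can contain such a point only if it hits [z]. *)
Definition hits (F : set 'cV[R]_n) k (z : 'cV[int]_n) : bool :=
  `[< exists2 x, F x &
      forall i, `|(x - Ainv A ^+ k *m rmx z) i ord0| <= C * c ^+ k >].

(** If [F] hits [z] and [z'], then A^-k (z - z') has norm at most n (1 + 2 C) c^k. Undoing the
    similarity removes c^k and leaves distinct integer vectors at bounded mutual distance. *)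
Lemma count_hits : exists M : nat, forall F k, (diam F <= 1%:E)%E ->
  fine (diam F) <= c ^+ k -> (count (hits F k) (lev k) <= M)%N.
Proof.
have [M latticeM] := @bounded_int_vectors R n (n%:R * (1 + 2 * C)).
exists M => F k F1 Fk; rewrite -size_filter; apply: latticeM.
  by rewrite filter_uniq// level_uniq.
move=> z z'; rewrite !mem_filter => /andP[/asboolP[x Fx xz] _].
move=> /andP[/asboolP[x' Fx' xz'] _].
have xx' := le_trans (eucl_le_fine_diam F1 Fx Fx') Fk.
have ck : 0 < c ^+ k by rewrite exprn_gt0.
rewrite -(ler_pM2l ck) -(eucl_AinvX eucl_Ainv) mulrCA; apply: eucl_le_coord => i.
rewrite realmxB mulmxBr; move: (xz i) (xz' i).
have := le_trans (coord_le_eucl _ i) xx'; rewrite !mxE.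
set u := \sum_j _; set v := \sum_j _; rewrite !ler_norml.
by move=> /andP[? ?] /andP[? ?] /andP[? ?]; apply/andP; split; lra.
Qed.

Section Growth.
Variables (s0 K s : R).
Hypothesis s_s0 : 0 <= s < s0.
Hypothesis growth_ge : forall k, 1 <= K * (size (lev k))%:R * (c `^ s0) ^+ k.
Local Notation q := (c `^ s0).

Let q_gt0 : 0 < q. Proof. exact: powR_gt0. Qed.
Let q_lt1 : q < 1.
Proof.
rewrite /powR gt_eqF// -[ltRHS]expR0 ltr_expR pmulr_rlt0 ?ln_lt0 ?c01//.
by case/andP: s_s0 => h1 h2; apply: le_lt_trans h2.
Qed.

(** For positive diameter d, take [k] with c^(k+1) < d <= c^k; then q^(k+1) <= d^s0 <= d^s because d
    <= 1. The slack [t] serves the sets of diameter 0, for which [k] is merely taken large. *)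
Lemma scale_exists (F : set 'cV[R]_n) t : (diam F <= 1%:E)%E -> 0 < t ->
  exists k, fine (diam F) <= c ^+ k /\
    ((q ^+ k)%:E <= q^-1%:E * hterm s F + t%:E)%E.
Proof.
move=> F1 t0; have /andP[s_ge0 ss0] := s_s0.
have d0 := fine_diam_ge0 F.
have d1 : fine (diam F) <= 1 by case: (diam F) F1 => [r||]; rewrite ?lee_fin.
have [dgt0|dle0] := ltP 0 (fine (diam F)); last first.
  have q01 : 0 <= q < 1 by rewrite ltW.
  have [k _ /(_ k (leqnn _))/= qk] := geometric_small 1 q01 t0.
  rewrite mul1r in qk; exists k; split.
    by rewrite (le_trans dle0)// exprn_ge0// ltW.
  apply: (@le_trans _ _ t%:E); first by rewrite lee_fin.
  by rewrite leeDr// mule_ge0 ?hterm_ge0// lee_fin invr_ge0 ltW.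
have [k ck] : exists k, c ^+ k.+1 < fine (diam F).
  have c01' : 0 <= c < 1 by rewrite ltW.
  have d2 : 0 < fine (diam F) / 2 by lra.
  have [k _ /(_ k.+1 (leqW (leqnn _)))/= h] := geometric_small 1 c01' d2.
  by exists k; rewrite mul1r in h; lra.
have {k ck} [k ck kmin] := ex_minnP (ex_intro (fun k => c ^+ k.+1 < fine (diam F)) k ck).
have dk : fine (diam F) <= c ^+ k.
  case: k ck kmin => [//|k] _ kmin; rewrite leNgt; apply/negP => /kmin.
  by rewrite ltnn.
exists k; split => //.
have -> : hterm s F = (fine (diam F) `^ s)%:E.
  rewrite /hterm; case: ifP => // /negP; rewrite asboolE => nF.
  have F0 : F = set0 by apply/eqP; apply: contra_notT nF => /set0P.
  by move: dgt0; rewrite F0 diam_set0 ltxx.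
rewrite -EFinM -EFinD lee_fin; apply: (@le_trans _ _ (q^-1 * fine (diam F) `^ s)); last first.
  by rewrite lerDl ltW.
rewrite -(ler_pM2l q_gt0) mulVKf ?gt_eqF// -exprS -(powRX _ _ (ltW c_gt0)).
apply: (@le_trans _ _ (fine (diam F) `^ s0)).
  have c_ge0 := ltW c_gt0.
  rewrite ge0_ler_powR ?nnegrE ?exprn_ge0// ?(ltW ck)//.
  exact: le_trans (ltW ss0).
by apply: ger_powR; rewrite ?dgt0// ltW.
Qed.

Lemma hausdorff_measure_digit_set_neq0 :
  hausdorff_measure s (digit_set A S : set 'cV[R]_n) <> 0%E.
Proof.
move=> H0; have [M hitsM] := count_hits.
(* A set at scale [k] hits at most [M] points, by [growth_ge] a proportion of at most M K q^k; the
   summand 1 keeps [W] positive when [M] is 0. *)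
pose W := M%:R * K + 1.
have K0 : 0 < K.
  have := growth_ge 0; rewrite expr0 mulr1 /= mulr1.
  by apply: lt_le_trans.
have W0 : 0 < W by rewrite ltr_wpDl// mulr_ge0// ltW.
(* These slacks sum to 1/(4 W), and [e0] bounds the contribution of the cover by the same amount, so
   the proportions at the root add up to less than 1/2. *)
have t0 i : 0 < (4 * W)^-1 / (2 ^ i.+1)%:R.
  by rewrite divr_gt0 ?invr_gt0 ?mulr_gt0// ltr0n expn_gt0.
have e0 : 0 < q / (4 * W) by rewrite divr_gt0// mulr_gt0.
have [F [EF F1 Fe]] := hausdorff_measure_eq0_cover H0 ltr01 e0.
have /choice[depth depthP] i := scale_exists (F1 i) (t0 i).
pose h i := hits (F i) (depth i).
have avg_le i : ((avg R A S (h i) (depth i) 0 0)%:E <=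
    W%:E * (q^-1%:E * hterm s (F i) + ((4 * W)^-1 / (2 ^ i.+1)%:R)%:E))%E.
  have [Fk qk] := depthP i; rewrite avg_root//.
  apply: (@le_trans _ _ (W * q ^+ depth i)%:E); last first.
    by rewrite EFinM lee_pmul2l.
  have lev0 : 0 < (size (lev (depth i)))%:R :> R.
    by rewrite ltr0n size_level_gt0.
  rewrite lee_fin ler_pdivrMr//.
  apply: (@le_trans _ _ M%:R); first by rewrite ler_nat hitsM.
  have := growth_ge (depth i) => gk.
  have : M%:R <= M%:R * (K * (size (lev (depth i)))%:R * q ^+ depth i).
    by rewrite ler_peMr.
  move/le_trans; apply; rewrite !mulrA mulrAC.
  do 2![rewrite ler_wpM2r ?(ltW lev0) ?exprn_ge0 ?(ltW q_gt0)//].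
  by rewrite lerDl.
have [e eS noth] : exists2 e, forall k, e k \in S k &
    forall i, ~~ h i (intpt A e (depth i)).
  apply: (@avoiding_path R n A S) => //.
  apply: (@le_lt_trans _ _ (W%:E *
      (\sum_(i <oo) (q^-1%:E * hterm s (F i)) + (4 * W)^-1%:E)))%E.
    have qh i : (0 <= q^-1%:E * hterm s (F i))%E.
      by rewrite mule_ge0 ?hterm_ge0// lee_fin invr_ge0 ltW.
    apply: (@le_trans _ _ (\sum_(i <oo) (W%:E *
        (q^-1%:E * hterm s (F i) + ((4 * W)^-1 / (2 ^ i.+1)%:R)%:E)))%E).
      apply: lee_nneseries => i _; last exact: avg_le.
      by move=> _; rewrite lee_fin avg_ge0.
    rewrite nneseriesZl; last by move=> i _; rewrite adde_ge0// lee_fin ltW.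
    rewrite lee_pmul2l//; apply: epsilon_trick => //.
    by rewrite invr_ge0 mulr_ge0// ltW.
  rewrite nneseriesZl; last by move=> i _; exact: hterm_ge0.
  apply: (@le_lt_trans _ _ (W%:E * (q^-1%:E * (q / (4 * W))%:E + (4 * W)^-1%:E))%E).
    by rewrite lee_pmul2l// leeD2r// lee_pmul2l ?ltW// lte_fin invr_gt0.
  rewrite -!(EFinM, EFinD) lte_fin.
  have -> : W * (q^-1 * (q / (4 * W)) + (4 * W)^-1) = 2^-1.
    by field; rewrite !gt_eqF.
  by lra.
(* The limit of the avoiding expansion lies in some [F i], which therefore hits its point at level
   [depth i]. *)
have [x ex] := @psum_cvg R n A c c01 eucl_Ainv B _ (fun k => S_bounded (eS k)).
have [i _ Fix] : (\bigcup_i F i) x by apply: EF; exists e.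
move/negP: (noth i); apply; apply/asboolP; exists x => // j.
exact: (digit_set_near detA c01 eucl_Ainv S_bounded).
Qed.

End Growth.
End LowerBound.

(** * Dimension formula *)

Section PeriodicGrowth.
Variables (R : realType) (N m : nat -> R) (p : nat) (q : R).
Hypothesis p_gt0 : (0 < p)%N.
Hypothesis N_gt0 : forall k, 0 < N k.
Hypothesis q_gt0 : 0 < q.
Hypothesis N_periodic : forall k, (p <= k)%N -> N k = m (k %% p)%N.
Hypothesis prod_period : q ^+ p * \prod_(l < p) m l = 1.

Let g k := (\prod_(j < k) N j) * q ^+ k.

Let gS k : g k.+1 = g k * (N k * q).
Proof. by rewrite /g big_ord_recr/= exprSr; ring. Qed.

Let g_gt0 k : 0 < g k.
Proof. by rewrite mulr_gt0 ?exprn_gt0// prodr_gt0. Qed.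

(** From k = p to 2p, [g] gains a full period of factors, whose product is 1; later indices follow
    since the successive ratios of [g] are periodic. *)
Let g_periodic k : (p <= k)%N -> g (k + p)%N = g k.
Proof.
elim: k => [|k ih]; first by rewrite leqNgt p_gt0.
rewrite leq_eqVlt => /predU1P[<-|pk]; last first.
  rewrite addSn !gS ih// N_periodic ?(leq_trans _ (leq_addr _ _))//.
  by rewrite modnDr [N k]N_periodic.
have shift : \prod_(i < p) N (rshift p i) = \prod_(l < p) m l.
  apply: eq_bigr => i _ /=.
  by rewrite N_periodic ?leq_addr// modnDl modn_small.
rewrite /g big_split_ord shift/= exprD mulrACA.
by rewrite [X in _ * X]mulrC prod_period mulr1.
Qed.

(** By periodicity every value of [g] occurs at an index below 2p, so the sum of these values and
    their inverses bounds both [g] and its inverse. *)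
Lemma periodic_growth : exists K, forall k,
  (\prod_(j < k) N j) * q ^+ k <= K /\ 1 <= K * ((\prod_(j < k) N j) * q ^+ k).
Proof.
exists (\sum_(j < p + p) (g j + (g j)^-1)) => k; rewrite -/(g k).
have [i ->] : exists i : 'I_(p + p), g k = g i.
  elim: k {-2}k (leqnn k) => [|b ih] k kb.
    have p0 : (0 < p + p)%N by rewrite addn_gt0 p_gt0.
    by exists (Ordinal p0); case: k kb.
  have [kp|pk] := ltnP k (p + p); first by exists (Ordinal kp).
  have [|i gi] := ih (k - p)%N; first by lia.
  have /subnK {1}<- : (p <= k)%N by lia.
  by exists i; rewrite g_periodic//; lia.
have gi : g i + (g i)^-1 <= \sum_(j < p + p) (g j + (g j)^-1).
  rewrite (bigD1 i)//= lerDl sumr_ge0// => j _.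
  by rewrite addr_ge0 ?invr_ge0// ltW.
split; first by apply: le_trans gi; rewrite lerDl invr_ge0 ltW.
rewrite -ler_pdivrMr// div1r; apply: le_trans gi.
by rewrite lerDr ltW.
Qed.

End PeriodicGrowth.

(** * Determinant of a linear similarity *)

Section SimilarityDet.
Variables (R : realType) (n : nat) (B : 'M[R]_n) (c : R).
Hypothesis c_ge0 : 0 <= c.
Hypothesis eucl_B : forall x : 'cV[R]_n, eucl (B *m x) = c * eucl x.

Let eucl_sqrE (x : 'cV[R]_n) : eucl x ^+ 2 = (x^T *m x) ord0 ord0.
Proof. by rewrite eucl_sqr !mxE; apply: eq_bigr => i _; rewrite mxE -expr2. Qed.

(** Polarization: the symmetric form of [M] vanishes on the diagonal, hence everywhere, and its
    values at basis vectors are the entries of [M]. *)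
Lemma similarity_gram : B^T *m B = (c ^+ 2)%:M.
Proof.
pose M := B^T *m B - (c ^+ 2)%:M.
pose b (x y : 'cV[R]_n) := (x^T *m M *m y) ord0 ord0.
have bxx x : b x x = 0.
  rewrite /b mulmxBr mulmxBl mxE [X in _ + X]mxE mul_mx_scalar -scalemxAl.
  rewrite [X in _ - X]mxE -eucl_sqrE !mulmxA -mulmxA -trmx_mul -eucl_sqrE.
  by rewrite eucl_B exprMn subrr.
have bC x y : b x y = b y x.
  have MT : M^T = M by rewrite /M linearB/= trmx_mul trmxK tr_scalar_mx.
  by rewrite /b -[in LHS](trmxK (x^T *m M *m y)) mxE !trmx_mul trmxK MT mulmxA.
have b0 x y : b x y = 0.
  have bDl u v w : b (u + v) w = b u w + b v w.
    have uv : (u + v)^T = u^T + v^T by rewrite linearD.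
    by rewrite /b uv !mulmxDl [LHS]mxE.
  have bDr u v w : b u (v + w) = b u v + b u w by rewrite /b mulmxDr [LHS]mxE.
  have := bxx (x + y); rewrite bDl !bDr.
  rewrite !bxx (bC y x) add0r addr0 => /eqP.
  by rewrite -mulr2n mulrn_eq0/= => /eqP.
apply/eqP; rewrite -subr_eq0; apply/eqP/matrixP => i j.
have := b0 (delta_mx i ord0) (delta_mx j ord0).
by rewrite /b trmx_delta -rowE -colE !mxE.
Qed.

Lemma similarity_det : `|\det B| = c ^+ n.
Proof.
have := congr1 determinant similarity_gram.
rewrite det_mulmx det_tr det_scalar -expr2 => dB.
apply/eqP; rewrite -(@eqrXn2 _ 2)// ?exprn_ge0//.
by rewrite real_normK ?num_real// dB -!exprM mulnC.
Qed.

End SimilarityDet.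

(** Since [A *m \adj A] is the scalar matrix of [\det A], vectors congruent coordinatewise modulo
    [\det A] are congruent modulo [A]. Reduction modulo [\det A] is thus injective on [D], with
    finitely many values. *)
Lemma residue_finite (n : nat) (A : 'M[int]_n) (D : set 'cV[int]_n) :
  \det A != 0 ->
  (forall d1 d2 z, D d1 -> D d2 -> d1 - d2 = A *m z -> d1 = d2) ->
  finite_set D.
Proof.
move=> detA Dres.
pose m := `|\det A|%N.
pose f (d : 'cV[int]_n) : {ffun 'I_n -> 'I_m.+1} :=
  [ffun i => inord `|(d i ord0 %% \det A)%Z|%N].
have f_inj d1 d2 : D d1 -> D d2 -> f d1 = f d2 -> d1 = d2.
  move=> D1 D2 /ffunP f12.
  have dvd i : (\det A %| (d1 - d2) i ord0)%Z.
    have /(congr1 (@nat_of_ord _)) := f12 i; rewrite !ffunE.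
    have lt_mod d : (`|(d %% \det A)%Z|%N < m.+1)%N.
      have := modz_ge0 d detA; have := ltz_mod d detA.
      by rewrite /m; lia.
    rewrite !inordK// => e12; rewrite !mxE -eqz_mod_dvd.
    have := modz_ge0 (d1 i ord0) detA; have := modz_ge0 (d2 i ord0) detA.
    by move=> h1 h2; apply/eqP; lia.
  apply: (Dres _ _ (\adj A *m \col_i ((d1 - d2) i ord0 %/ \det A)%Z)) => //.
  rewrite mulmxA mul_mx_adj mul_scalar_mx; apply/matrixP => i j.
  by rewrite [j]ord1 [RHS]mxE [X in _ = _ * X]mxE mulrC divzK.
pose g y := xget 0 [set d | D d /\ f d = y].
apply: (@sub_finite_set _ _ (g @` (f @` D))); last first.
  by apply: finite_image; exact: finite_finset.
move=> d Dd; exists (f d); first by exists d.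
rewrite /g; case: xgetP => [d' _ [Dd' /f_inj]|/(_ d)]; first exact.
by case.
Qed.

Section Dimension.
Variables (R : realType) (n : nat) (A : 'M[int]_n) (c B : R).
Variables (S : nat -> seq 'cV[int]_n) (m : nat -> nat) (p : nat).
Hypothesis detA : \det A != 0.
Hypothesis c01 : 0 < c < 1.
Hypothesis eucl_Ainv : forall x : 'cV[R]_n, eucl (Ainv A *m x) = c * eucl x.
Hypothesis S_bounded : forall k d, d \in S k ->
  eucl (Defs.realmx d : 'cV[R]_n) <= B.
Hypothesis S_nonempty : forall k, (0 < size (S k))%N.
Hypothesis S_uniq : forall k, uniq (S k).
Hypothesis S_residue : forall k d1 d2 z, d1 \in S k -> d2 \in S k ->
  d1 - d2 = A *m z -> d1 = d2.
Hypothesis p_gt0 : (0 < p)%N.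
Hypothesis S_periodic : forall k, (p <= k)%N -> size (S k) = m (k %% p)%N.

Theorem hausdorff_dim_digit_set : hausdorff_dim (digit_set A S : set 'cV[R]_n)
  = (ln (\prod_(l < p) (m l)%:R) / (p%:R * ln c^-1))%:E.
Proof.
set P : R := \prod_(l < p) _; set s0 := _ / _.
have /andP[c_gt0 c_lt1] := c01.
have lnc : ln c < 0 by rewrite ln_lt0.
have p0 : 0 < p%:R :> R by rewrite ltr0n.
(* The index [p + l] lies in the periodic range and reduces to [l]. *)
have m_gt0 (l : 'I_p) : (0 < m l)%N.
  by rewrite -(modn_small (ltn_ord l)) -modnDl -S_periodic ?leq_addr.
have P1 : 1 <= P by rewrite /P -natr_prod ler1n prodn_gt0.
have P0 : 0 < P by apply: lt_le_trans P1.
have s0_ge0 : 0 <= s0.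
  by rewrite divr_ge0 ?ln_ge0// lnV ?posrE// mulr_ge0// oppr_ge0 ltW.
(* This equation determines [s0]: over one period the growth in number balances the contraction. *)
have qP : (c `^ s0) ^+ p * P = 1.
  rewrite /powR gt_eqF// -expRM_natl /s0 lnV ?posrE//.
  have -> : p%:R * (ln P / (p%:R * - ln c) * ln c) = - ln P.
    by field; rewrite (lt_eqF lnc) gt_eqF.
  by rewrite expRN lnK ?posrE// mulVf ?gt_eqF.
have [K growth] := @periodic_growth R (fun k => (size (S k))%:R) (fun l => (m l)%:R)
  p (c `^ s0) p_gt0 (fun k => etrans (ltr0n _ _) (S_nonempty k))
  (powR_gt0 s0 c_gt0) (fun k pk => congr1 (GRing.natmul 1) (S_periodic pk)) qP.
have sizeE k : (size (level A S k))%:R = \prod_(j < k) (size (S j))%:R :> R.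
  by rewrite size_level natr_prod.
apply: hausdorff_dimE => // s ss0.
  apply: (hausdorff_measure_digit_set0 detA c01 eucl_Ainv S_bounded _
    s0_ge0 (K := K)) => // k.
  by rewrite sizeE; have [] := growth k.
apply: (hausdorff_measure_digit_set_neq0 detA c01 eucl_Ainv S_bounded _ _ _
  ss0 (K := K)) => // k.
by rewrite -mulrA sizeE; have [] := growth k.
Qed.

End Dimension.

(** * The intersection as a digit set *)

Section Intersection.
Variables (R : realType) (n : nat) (A : 'M[int]_n) (D : set 'cV[int]_n).
Variables (alpha : 'cV[R]_n) (a : nat -> 'cV[R]_n).
Local Notation rmx := (@Defs.realmx R _ _).
Local Notation RD := (realset D : set 'cV[R]_n).
Hypothesis a_rep : is_rep A (setdiff_vec RD RD) alpha a.
Hypothesis a_unique :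
  forall e, is_rep A (setdiff_vec RD RD) alpha e -> e = a.

Lemma psumB_cvg (e f : nat -> 'cV[R]_n) (x y : 'cV[R]_n) :
  psum A e @ \oo --> x -> psum A f @ \oo --> y ->
  psum A (fun j => e j - f j) @ \oo --> x - y.
Proof.
move=> ex fy.
have -> : psum A (fun j => e j - f j) = fun k => psum A e k - psum A f k.
  apply/funext => k; rewrite /psum -sumrB.
  by apply: eq_bigr => j _; rewrite mulmxBr.
exact: cvgB.
Qed.

(** If x = y + alpha with digits [e] and [f], then e - f represents [alpha], so it equals [a] and
    each e_k lies in D and D + a_k. Conversely, subtracting [a] from the digits of [x] gives digits
    in [D] for x - alpha. *)
Lemma T_AE_translate_digit_set (S : nat -> seq 'cV[int]_n) :
  (forall k d, d \in S k <-> D d /\ exists2 d', D d' & rmx d = rmx d' + a k) ->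
  T_AE A RD `&` translate (T_AE A RD) alpha = digit_set A S.
Proof.
move=> SP; apply/seteqP; split => [x [[e [eD ex]] [y [f [fD fy]] yx]]|x].
  have ef : (fun k => e k - f k) = a.
    apply: a_unique; split=> [k|]; first by exists (e k), (f k).
    have -> : alpha = x - y by rewrite -yx addrC addKr.
    exact: psumB_cvg.
  have /choice[d dP] k : exists d, D d /\ rmx d = e k by case: (eD k) => d ? <-; exists d.
  exists d; split => [k|]; last first.
    by under [fun k => rmx (d k)]eq_fun do rewrite (dP _).2.
  apply/SP; split; first by case: (dP k).
  have [d' Dd' d'f] := fD k; exists d' => //.
  by rewrite (dP k).2 d'f -ef addrC subrK.
move=> [d [dS dx]].
have /choice[d' d'P] k : exists d', D d' /\ rmx (d k) = rmx d' + a k.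
  by have /SP[_ [d' ? ?]] := dS k; exists d'.
split.
  exists (fun k => rmx (d k)); split => // k.
  by exists (d k) => //; have /SP[] := dS k.
exists (x - alpha); last by rewrite subrK.
exists (fun k => rmx (d' k)); split => [k|].
  by exists (d' k) => //; case: (d'P k).
have := psumB_cvg dx a_rep.2.
have -> : (fun k => rmx (d k) - a k) = (fun k => rmx (d' k)); last exact.
by apply/funext => k; rewrite (d'P k).2 addrK.
Qed.

End Intersection.

Lemma card_fset_set_image (T U : choiceType) (f : T -> U) (s : seq T) :
  injective f -> uniq s -> #|` fset_set [set f x | x in [set` s]] |%fset = size s.
Proof.
move=> f_inj us.
have -> : [set f x | x in [set` s]] = [set` [fset y in map f s]%fset].
  apply/seteqP; split=> y /=; rewrite inE.
    by move=> [x xs <-]; exact: map_f.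
  by move=> /mapP[x xs ->]; exists x.
by rewrite set_fsetK card_fseq undup_id ?size_map// map_inj_uniq.
Qed.

Lemma similarity_det_int (R : realType) (n : nat) (A : 'M[int]_n) (c : R) :
  \det A != 0 -> 0 <= c ->
  (forall x : 'cV[R]_n, eucl (Ainv A *m x) = c * eucl x) ->
  (`|\det A|%:~R : R) = c ^- n.
Proof.
move=> detA c0 /(similarity_det c0).
rewrite det_inv det_map_mx normrV ?unitfE ?intr_eq0// -intr_norm => <-.
by rewrite invrK.
Qed.

Unset Implicit Arguments.

Theorem mainTheorem7 (R : realType) (n : nat) (A : 'M[int]_n) (D : set 'cV[int]_n)
  (alpha : 'cV[R]_n) (a : nat -> 'cV[R]_n) (p : nat)
  (U V : nat -> set 'cV[R]_n) (beta : nat -> 'cV[R]_n) :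
  \det A != 0 ->
  is_similarity (fun x : 'cV[R]_n => Ainv A *m x) ->
  (exists C, complete_residue_system A C /\ D `<=` C) ->
  is_rep A (setdiff_vec (realset D) (realset D)) alpha a ->
  (forall e, is_rep A (setdiff_vec (realset D) (realset D)) alpha e -> e = a) ->
  (0 < p)%N ->
  (forall l, (l < p)%N -> finite_set (U l) /\ finite_set (V l)) ->
  (forall k, realset D (beta k)) ->
  (forall k, (k < p)%N ->
     translate (realset D `&` translate (realset D) (a k)) (- beta k) = U k) ->
  (forall k, (p <= k)%N ->
     translate (realset D `&` translate (realset D) (a k)) (- beta k)
       = setadd_vec (U (k %% p)%N) (V (k %% p)%N)) ->
  hausdorff_dim (T_AE A (realset D) `&` translate (T_AE A (realset D)) alpha)
  = (ln (\prod_(l < p) (#|` fset_set (setadd_vec (U l) (V l)) |)%fset%:R)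
      / (p%:R * ln ((`|\det A|%:~R : R) `^ (n%:R)^-1)))%:E.
Proof.
move=> detA [c [c01 sim]] [C [[C_inj _] DC]] a_rep a_unique p_gt0 _ _ _ Xlate.
have /andP[c_gt0 c_lt1] := c01.
have eucl_Ainv (x : 'cV[R]_n) : eucl (Ainv A *m x) = c * eucl x.
  by have := sim x 0; rewrite mulmx0 !subr0.
have D_residue d1 d2 z : D d1 -> D d2 -> d1 - d2 = A *m z -> d1 = d2.
  by move=> /DC C1 /DC C2 dz; apply: C_inj => //; exists z.
have /finite_seqP[sD DE] := residue_finite detA D_residue.
pose P k d := `[< exists2 d', D d' &
  Defs.realmx d = Defs.realmx d' + a k :> 'cV[R]_n >].
pose S k := [seq d <- undup sD | P k d].
have SP k d : d \in S k <-> D d /\ exists2 d', D d' &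
    Defs.realmx d = Defs.realmx d' + a k :> 'cV[R]_n.
  rewrite mem_filter mem_undup; split=> [/andP[/asboolP Pd ds]|[Dd Pd]].
    by rewrite DE; split => //; move: Pd; rewrite DE.
  by apply/andP; split; [apply/asboolP | move: Dd; rewrite DE].
have S_uniq k : uniq (S k) by rewrite filter_uniq// undup_uniq.
have S_nonempty k : (0 < size (S k))%N.
  (* A digit [a k] is a difference d - d' of elements of [D], and this [d] belongs to [S k]. *)
  have [_ [_ [[d Dd <-] [[d' Dd' <-] akE]]]] := a_rep.1 k.
  have : d \in S k by apply/SP; split=> //; exists d'; rewrite // akE addrC subrK.
  by case: (S k).
have S_residue k d1 d2 z : d1 \in S k -> d2 \in S k ->
    d1 - d2 = A *m z -> d1 = d2.
  by move=> /SP[D1 _] /SP[D2 _]; exact: D_residue.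
pose B : R := \sum_(d <- sD) eucl (Defs.realmx d : 'cV[R]_n).
have S_bounded k d : d \in S k -> eucl (Defs.realmx d : 'cV[R]_n) <= B.
  move=> /SP[]; rewrite DE /= => dsD _.
  by rewrite /B (big_rem d)//= lerDl sumr_ge0// => *; exact: eucl_ge0.
pose m l := #|` fset_set (setadd_vec (U l) (V l))|%fset.
have S_periodic k : (p <= k)%N -> size (S k) = m (k %% p)%N.
  (* Embedding into the reals and translating by [- beta k] are injective, so the set in [Xlate] has
     as many elements as [S k]. *)
  move=> pk; rewrite /m -Xlate//.
  rewrite -(@card_fset_set_image _ _ (fun d => Defs.realmx d - beta k) (S k))//.
    congr (#|` fset_set _ |)%fset; apply/seteqP; split => [_ [d /SP[Dd [d' Dd' dd']] <-]|].
      exists (Defs.realmx d) => //; split; first by exists d.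
      by exists (Defs.realmx d') => //; exists d'.
    move=> _ [_ [[d Dd <-] [_ [d' Dd' <-] d'd]] <-]; exists d => //.
    by apply/SP; split => //; exists d'.
  by move=> d d' /addIr/realmx_inj.
rewrite (T_AE_translate_digit_set a_rep a_unique SP).
rewrite (hausdorff_dim_digit_set detA c01 eucl_Ainv S_bounded S_nonempty S_uniq
  S_residue p_gt0 S_periodic).
congr _%:E; rewrite (similarity_det_int detA (ltW c_gt0) eucl_Ainv).
(* For [n = 0] the determinant does not determine [c], but both quotients have
   numerator [ln 1] since every [S k] is a singleton. *)
have [n0|n_gt0] := posnP n.
  rewrite big1 ?ln1 ?mul0r// => l _; apply/eqP.
  have -> : m l = size (S (p + l)%N).
    by rewrite S_periodic ?leq_addr// modnDl modn_small.
  rewrite pnatr_eq1 eqn_leq S_nonempty andbT.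
  apply: (@uniq_leq_size _ _ [:: 0]) => // d _; rewrite inE; apply/eqP/matrixP.
  by move=> i; have : (i < 0)%N by rewrite -[X in (_ < X)%N]n0.
(* For positive [n], the [n]-th root of c^-n is c^-1. *)
have cV_ge0 : 0 <= c^-1 by rewrite invr_ge0 ltW.
by rewrite -exprVn -powR_mulrn// -powRrM divff ?pnatr_eq0 -?lt0n// powRr1.
Qed.
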